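(* The Ramanujan integral $I_R(x)=\int_0^\infty e^{-xt}\,\dfrac{dt}{t(\pi^2+\log^2 t)}$, $x>0$, admits an antiderivative $\tilde I_R(x)$ on $(0,\infty)$ which is a Bernstein function. Moreover, it possesses the explicit representation $$\tilde I_R(x)=a+\int_0^\infty\left(1-e^{-xt}\right)\frac{dt}{t\left(\pi^2+\log^2 t\right)},\qquad x>0,$$ where $a$ is a non-negative constant given by $a=\tilde I_R(0+)$.
   Context: $\log^2 t$ means $(\log t)^2$, and $\tilde I_R(0+)=\lim_{x\to0^+}\tilde I_R(x)$. A function $f:(0,\infty)\to\mathbb{R}$ is a Bernstein function if it is non-negative, infinitely differentiable, and $(-1)^{n-1}f^{(n)}(x)\ge 0$ for all $x>0$ and all integers $n\ge 1$ (equivalently, $f\ge0$ and $f'$ is completely monotonic).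
   Formalization: The representation is proved with dt/(t²(π²+log² t)) in place of the printed dt/(t(π²+log² t)): the printed right-hand side equals a+1−I_R(x), whose derivative tends to infinity as x→0+, whereas I_R(0+)=1, so no antiderivative of I_R has the printed form. *)

(* Defs.v *)
From HB Require Import structures.
From mathcomp Require Import all_boot all_order all_algebra.
From mathcomp Require Import all_classical all_reals all_analysis.

Set Implicit Arguments.
Unset Strict Implicit.
Unset Printing Implicit Defensive.

Import Order.TTheory GRing.Theory Num.Theory.
Import numFieldNormedType.Exports.

Local Open Scope ring_scope.
Local Open Scope classical_set_scope.

(* Functions on (0, +oo) are represented by total functions R -> R whose values
   outside ]0, +oo[ are irrelevant: only germs at points x > 0 are used. *)

(* Existence of every iterated derivative at every point of the open half-line
   is infinite differentiability there. *)
Definition bernstein (R : realType) (f : R -> R) : Prop :=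
  [/\ forall x : R, 0 < x -> 0 <= f x,
      forall (n : nat) (x : R), 0 < x -> derivable f^`(n)%classic x 1
    & forall (n : nat) (x : R), (1 <= n)%N -> 0 < x ->
        0 <= (-1) ^+ n.-1 * f^`(n)%classic x].

(* The integral is a Lebesgue integral with values in \bar R; as the integrand
   is non-negative, this is also the value of the improper integral. *)
Definition ramanujan_integral (R : realType) (x : R) : \bar R :=
  (\int[@lebesgue_measure R]_(t in `]0%R, +oo[)
     (expR (- (x * t)) / (t * (pi ^+ 2 + ln t ^+ 2)))%:E)%E.

(* Since F^`() x is a real number, this includes finiteness of the integral. *)
Definition ramanujan_antiderivative (R : realType) (F : R -> R) : Prop :=
  forall x : R, 0 < x ->
    derivable F x 1 /\ (F^`()%classic x)%:E = ramanujan_integral x.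

(* The factor t ^+ 2 is one power of t more than in the Ramanujan integral:
   the derivative of 1 - e^{-xt} with respect to x is t e^{-xt}, so exactly this
   integral has derivative ramanujan_integral x. *)
Definition ramanujan_levy_integral (R : realType) (x : R) : \bar R :=
  (\int[@lebesgue_measure R]_(t in `]0%R, +oo[)
     ((1 - expR (- (x * t))) / (t ^+ 2 * (pi ^+ 2 + ln t ^+ 2)))%:E)%E.

(* Main.v *)
Require Import Defs.
From HB Require Import structures.
From mathcomp Require Import all_boot all_order all_algebra.
From mathcomp Require Import all_classical all_reals all_analysis.
From mathcomp Require Import measurable_realfun ring lra.

Import Order.TTheory GRing.Theory Num.Theory.
Import numFieldNormedType.Exports.

Local Open Scope ring_scope.
Local Open Scope classical_set_scope.

(** Write w(t) = 1 / (t (pi^2 + log^2 t)) for the Ramanujan weight and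
    v(t) = w(t) / t.  The decisive fact is that w is integrable on (0, +oo):
    its primitive (1 / pi) atan (log t / pi) is bounded, so the integrals of w
    over compact intervals are at most 1 ([integral_ramanujan_weight_le1]), and
    these intervals exhaust the half-line ([integrable_ramanujan_weight]).

    The rest holds for every density v >= 0 such that t v(t) is integrable.
    Then L(x) = int (1 - e^{-xt}) v(t) dt is finite, since
    1 - e^{-xt} <= x t.  Differentiating under the integral sign gives
    L^(n+1)(x) = (-1)^n int t^(n+1) e^{-xt} v(t) dt, the dominating functions
    being multiples of t v(t) because t^n e^{-xt} is bounded on (0, +oo).  All
    these integrals are non-negative, so L is a Bernstein function
    ([bernstein_levyR]); for the Ramanujan density, L' is the Ramanujan
    integral.

    Two antiderivatives on the half-line differ by a constant
    ([eq_derive_pos_cst]), so an arbitrary one is F = a + L.  As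
    0 <= L(x) <= x int t v(t) dt, L vanishes at 0+ ([levyR_cvg0]); hence
    a = F(0+), which is non-negative when F is. *)

(** * Calculus on the half-line *)

Section half_line.
Context {R : realType}.

Lemma mem_pos (t : R) : `]0%R, +oo[ t -> 0 < t.
Proof. by rewrite /= in_itv/= andbT. Qed.

(** The factor [t ^+ n] is absorbed by the term of order [n] in the exponential
    series of [u * t]. *)
Lemma exprn_expRN_le (n : nat) (u t : R) : 0 < u -> 0 <= t ->
  t ^+ n * expR (- (u * t)) <= n`!%:R / u ^+ n.
Proof.
move=> u0 t0; have ut0 : 0 <= u * t by rewrite mulr_ge0// ltW.
have fac : (u * t) ^+ n <= n`!%:R * expR (u * t).
  case: n => [|n].
    by rewrite expr0 fact0 mul1r (le_trans _ (expR_ge1Dx _))// lerDl.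
  rewrite [leRHS]mulrC -ler_pdivrMr ?ltr0n ?fact_gt0//.
  by apply: le_trans (expR_ge1Dxn n ut0); rewrite lerDr.
rewrite expRN ler_pdivlMr ?exprn_gt0// mulrAC ler_pdivrMr ?expR_gt0//.
by rewrite -exprMn [t * u]mulrC.
Qed.

Lemma is_derive_expRN (x t : R) :
  is_derive x 1 (fun y : R => expR (- (y * t))) (- (t * expR (- (x * t)))).
Proof.
have h : is_derive x 1 (fun y : R => - (y * t)) (- t).
  apply: is_derive_eq.
  by rewrite /GRing.scale/= !mulr1 ?mulr0 ?addr0 ?add0r.
rewrite mulrC -mulrN.
exact: (@is_derive1_comp R expR (fun y : R => - (y * t)) x _ _
  (is_derive_expR _) h).
Qed.

Lemma eq_derive_pos_cst (F G : R -> R) (D : R -> R) :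
  (forall x : R, 0 < x -> is_derive x 1 F (D x)) ->
  (forall x : R, 0 < x -> is_derive x 1 G (D x)) ->
  forall x : R, 0 < x -> F x = F 1 - G 1 + G x.
Proof.
move=> dF dG.
have dH (x : R) : 0 < x -> is_derive x 1 (fun y : R => F y - G y) 0.
  move=> x0; have h1 := dF _ x0; have h2 := dG _ x0.
  by apply: is_derive_eq; rewrite subrr.
have H (x y : R) : 0 < x -> x < y -> F y - G y = F x - G x.
  move=> x0 xy.
  have [||c _ ] := @MVT _ (fun y : R => F y - G y) (fun=> 0) _ _ xy.
  - move=> z; rewrite in_itv/= => /andP[xz _]; apply: dH; exact: lt_trans xz.
  - apply: derivable_within_continuous => z; rewrite in_itv/= => /andP[xz _].
    by have [] := dH _ (lt_le_trans x0 xz).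
  - by rewrite mul0r => /eqP; rewrite subr_eq0 => /eqP.
move=> x x0.
suff -> : F 1 - G 1 = F x - G x by rewrite subrK.
have [x1|x1|->//] := ltgtP x 1; first exact: H.
by apply/esym/H.
Qed.

End half_line.

(** * Lévy integrals with integrable weight *)

Section levy_integral.
Context {R : realType}.
Local Notation mu := (@lebesgue_measure R).
(* The type is the copy of R that carries the measurable structure on which the
   Lebesgue measure is defined. *)
Local Notation pos := (`]0%R, +oo[ : set (measurableTypeR R)).

Variable v : R -> R.
Hypothesis v_ge0 : forall t, 0 < t -> 0 <= v t.
Hypothesis mv : measurable_fun pos v.
Hypothesis iv : mu.-integrable pos (fun t => (t * v t)%:E).

(** The Bernstein function with Lévy density [v] and neither drift nor constant
    term, as a real number. *)
Definition levyR (x : R) : R :=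
  \int[mu]_(t in pos) ((1 - expR (- (x * t))) * v t).

(** The Laplace transform of [t ^+ n.+1 * v t]. It starts at the
    weight [t * v t], as [v] itself need not be integrable near 0. *)
Definition laplaceR (n : nat) (x : R) : R :=
  \int[mu]_(t in pos) (t ^+ n.+1 * expR (- (x * t)) * v t).

Lemma integrable_le_weight (C : R) (g : R -> R) :
  measurable_fun pos g -> (forall t, 0 < t -> `|g t| <= C * (t * v t)) ->
  mu.-integrable pos (EFin \o g).
Proof.
move=> mg gC; have mpos : measurable pos by exact: measurable_itv.
apply: (le_integrable mpos _ _ (integrableZl mpos C iv)).
  exact/measurable_EFinP.
move=> t /mem_pos t0; rewrite -EFinM /= lee_fin.
exact: le_trans (gC _ t0) (ler_norm _).
Qed.

Lemma measurable_expRN (x : R) :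
  measurable_fun pos (fun t : R => expR (- (x * t))).
Proof.
by do 2 apply: measurableT_comp => //; exact: measurable_funM.
Qed.

Lemma integrable_levy (x : R) : 0 < x ->
  mu.-integrable pos (EFin \o (fun t => (1 - expR (- (x * t))) * v t)).
Proof.
move=> x0; apply: (@integrable_le_weight x).
  by apply: measurable_funM => //; apply: measurable_funB => //;
    exact: measurable_expRN.
move=> t t0; have xt0 : 0 < x * t by rewrite mulr_gt0.
have e1 : 0 <= 1 - expR (- (x * t)).
  by rewrite subr_ge0 -expR0 ler_expR oppr_le0 ltW.
rewrite ger0_norm ?mulr_ge0 ?v_ge0// mulrA ler_wpM2r ?v_ge0//.
by rewrite lerBlDr -lerBlDl; exact: expR_ge1Dx.
Qed.

(** The bound is uniform in [x >= u], as the domination of the derivatives near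
    a given point requires. *)
Lemma laplace_kernel_le (n : nat) (u x t : R) : 0 < u -> u <= x -> 0 < t ->
  `|t ^+ n.+1 * expR (- (x * t)) * v t| <= n`!%:R / u ^+ n * (t * v t).
Proof.
move=> u0 ux t0.
rewrite ger0_norm ?mulr_ge0 ?exprn_ge0 ?expR_ge0 ?v_ge0 ?(ltW t0)//.
have -> : t ^+ n.+1 * expR (- (x * t)) * v t =
  t ^+ n * expR (- (x * t)) * (t * v t) by rewrite exprS; ring.
rewrite ler_wpM2r ?mulr_ge0 ?v_ge0 ?(ltW t0)//.
apply: le_trans (exprn_expRN_le n _ _ u0 (ltW t0)).
by rewrite ler_wpM2l ?exprn_ge0 ?(ltW t0)// ler_expR lerN2 ler_pM2r.
Qed.

Lemma integrable_laplace (n : nat) (x : R) : 0 < x ->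
  mu.-integrable pos (EFin \o (fun t => t ^+ n.+1 * expR (- (x * t)) * v t)).
Proof.
move=> x0; apply: (@integrable_le_weight (n`!%:R / x ^+ n)).
  apply: measurable_funM => //; apply: measurable_funM.
    exact: measurable_funX.
  exact: measurable_expRN.
by move=> t t0; exact: laplace_kernel_le.
Qed.

(** Differentiation under the integral sign at [x], with domination by a
    multiple of the weight on the neighbourhood `](x / 2), (2 * x)[ of [x]. *)
Lemma is_derive_Rintegral_weight (f df : R -> R -> R) (x C : R) : 0 < x ->
  (forall y : R, 0 < y -> mu.-integrable pos (EFin \o f y)) ->
  (forall y t : R, 0 < y -> 0 < t -> is_derive y 1 (f ^~ t) (df y t)) ->
  (forall y t : R, x / 2 <= y -> 0 < t -> `|df y t| <= C * (t * v t)) ->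
  is_derive x 1 (fun y : R => \int[mu]_(t in pos) f y t)
    (\int[mu]_(t in pos) df x t).
Proof.
move=> x0 intf fdf dfC.
have d1f (y t : R) : 0 < y -> 0 < t -> partial1of2 f y t = df y t.
  by move=> y0 t0; rewrite partial1of2E; have [] := fdf _ _ y0 t0.
have xI : `](x / 2), (2 * x)[ x by rewrite /= in_itv/=; lra.
have posI (y : R) : `](x / 2), (2 * x)[ y -> x / 2 <= y /\ 0 < y.
  by rewrite /= in_itv/=; lra.
have intfI (y : R) : `](x / 2), (2 * x)[ y -> mu.-integrable pos (EFin \o f y).
  by case/posI => _; exact: intf.
have derf (y t : R) : `](x / 2), (2 * x)[ y -> pos t -> derivable (f ^~ t) y 1.
  by case/posI => _ y0 /mem_pos t0; have [] := fdf _ _ y0 t0.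
(* The absolute value makes the dominating function non-negative for every t,
   and not only on the half-line. *)
pose G (t : R) : R := `|C * (t * v t)|.
have G0 t : 0 <= G t by exact: normr_ge0.
have mpos : measurable pos by exact: measurable_itv.
have intG : mu.-integrable pos (EFin \o G).
  apply: (@integrable_le_weight `|C|).
    apply: measurableT_comp => //; apply: measurable_funM => //.
    exact: measurable_funM.
  move=> t t0; rewrite /G normr_id normrM (ger0_norm (_ : 0 <= t * v t))//.
  by rewrite mulr_ge0 ?v_ge0// ltW.
have Gub (y t : R) : `](x / 2), (2 * x)[ y -> pos t ->
    `|partial1of2 f y t| <= G t.
  move=> /posI[xy y0] /mem_pos t0; rewrite d1f//.
  exact: le_trans (dfC _ _ xy t0) (ler_norm _).
apply: DeriveDef.
  exact: (derivable_under_integral mpos xI intfI derf G0 intG Gub).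
rewrite -derive1E.
rewrite (differentiation_under_integral mpos xI intfI derf G0 intG Gub).
by apply: eq_Rintegral => t /[!inE] /mem_pos t0; exact: d1f.
Qed.

Lemma is_derive_levy (x : R) : 0 < x -> is_derive x 1 levyR (laplaceR 0 x).
Proof.
move=> x0; apply: (@is_derive_Rintegral_weight _
  (fun y t : R => t ^+ 1 * expR (- (y * t)) * v t) _
  (0`!%:R / (x / 2) ^+ 0)) => //.
- exact: integrable_levy.
- move=> y t _ _; have h := is_derive_expRN y t.
  apply: is_derive_eq.
  by rewrite /GRing.scale/= mulr0 add0r expr1; ring.
- by move=> y t xy t0; apply: laplace_kernel_le => //; lra.
Qed.

Lemma is_derive_laplace (n : nat) (x : R) : 0 < x ->
  is_derive x 1 (laplaceR n) (- laplaceR n.+1 x).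
Proof.
move=> x0.
have -> : - laplaceR n.+1 x =
    \int[mu]_(t in pos) (- (t ^+ n.+2 * expR (- (x * t)) * v t)).
  rewrite /laplaceR -mulN1r -RintegralZl//; last exact: integrable_laplace.
  by apply: eq_Rintegral => t _; rewrite mulN1r.
apply: (@is_derive_Rintegral_weight _
  (fun y t : R => - (t ^+ n.+2 * expR (- (y * t)) * v t)) _
  (n.+1`!%:R / (x / 2) ^+ n.+1)) => //.
- exact: integrable_laplace.
- move=> y t _ _; have h := is_derive_expRN y t.
  apply: is_derive_eq.
  by rewrite /GRing.scale/= !mulr0 ?add0r ?addr0 [in RHS]exprS; ring.
- by move=> y t xy t0; rewrite normrN; apply: laplace_kernel_le => //; lra.
Qed.

Lemma levyR_ge0 (x : R) : 0 < x -> 0 <= levyR x.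
Proof.
move=> x0; apply: Rintegral_ge0 => t /mem_pos t0; rewrite mulr_ge0 ?v_ge0//.
by rewrite subr_ge0 -expR0 ler_expR oppr_le0 mulr_ge0// ltW.
Qed.

Lemma laplaceR_ge0 (n : nat) (x : R) : 0 <= laplaceR n x.
Proof.
apply: Rintegral_ge0 => t /mem_pos t0.
by rewrite !mulr_ge0 ?v_ge0 ?exprn_ge0 ?expR_ge0// ltW.
Qed.

Lemma derive1n_levyR (n : nat) (x : R) : 0 < x ->
  levyR^`(n.+1) x = (-1) ^+ n * laplaceR n x.
Proof.
elim: n x => [|n IH] x x0.
  by rewrite expr0 mul1r /= derive1E; have [] := is_derive_levy _ x0.
rewrite derive1nS derive1E.
rewrite (@near_eq_derive _ _ _ _ (fun y : R => (-1) ^+ n * laplaceR n y));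
  last first.
  by near=> y; apply: IH; near: y; exact: lt_nbhsr.
have h := is_derive_laplace n _ x0.
rewrite derive_val /GRing.scale/= exprS.
by ring.
Unshelve. all: by end_near. Qed.

Lemma bernstein_levyR : bernstein levyR.
Proof.
split.
- exact: levyR_ge0.
- case=> [|n] x x0; first by have [] := is_derive_levy _ x0.
  apply: (@near_eq_derivable _ _ _ (fun y : R => (-1) ^+ n * laplaceR n y)).
    by near=> y; apply/esym/derive1n_levyR; near: y; exact: lt_nbhsr.
  have h := is_derive_laplace n _ x0.
  exact: ex_derive.
- case=> [//|n] x _ x0; rewrite derive1n_levyR// mulrA -exprMn mulrNN mulr1.
  by rewrite expr1n mul1r laplaceR_ge0.
Unshelve. all: by end_near. Qed.

Lemma levyR_cvg0 : levyR x @[x --> 0^'+] --> (0 : R).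
Proof.
pose m := \int[mu]_(t in pos) (t * v t).
have mpos : measurable pos by exact: measurable_itv.
have ub (x : R) : 0 < x -> levyR x <= x * m.
  move=> x0; rewrite /m -(RintegralZl _ mpos iv).
  apply: (le_Rintegral mpos).
  - exact: integrable_levy.
  - exact: (integrableZl mpos x iv).
  - move=> t /mem_pos t0; rewrite mulrA ler_wpM2r ?v_ge0//.
    by rewrite lerBlDr -lerBlDl; exact: expR_ge1Dx.
apply: (@squeeze_cvgr _ _ _ _ (fun=> 0) (fun x : R => x * m)).
- near=> x; have x0 : 0 < x by near: x; exact: nbhs_right_gt.
  by rewrite levyR_ge0// ub.
- exact: cvg_cst.
- rewrite -[X in _ --> X](mul0r m); apply: cvgM; last exact: cvg_cst.
  by apply: cvg_at_right_filter; exact: cvg_id.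
Unshelve. all: by end_near. Qed.

End levy_integral.

(** * The Ramanujan density *)

Section ramanujan_density.
Context {R : realType}.
Local Notation mu := (@lebesgue_measure R).
Local Notation pos := (`]0%R, +oo[ : set (measurableTypeR R)).

(** The Lévy density of the Ramanujan integral: the kernel of the integral
    divided by one more power of [t]. *)
Definition ramanujan_density (t : R) : R :=
  (t ^+ 2 * (pi ^+ 2 + ln t ^+ 2))^-1.

Local Notation v := ramanujan_density.

Lemma pi2_ln2_gt0 (t : R) : 0 < pi ^+ 2 + ln t ^+ 2.
Proof. by rewrite ltr_pwDl ?exprn_gt0 ?pi_gt0// sqr_ge0. Qed.

Lemma ramanujan_density_ge0 (t : R) : 0 <= v t.
Proof. by rewrite invr_ge0 mulr_ge0 ?sqr_ge0// ltW// pi2_ln2_gt0. Qed.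

Lemma continuous_ramanujan_density (t : R) : 0 < t -> {for t, continuous v}.
Proof.
move=> t0.
apply: (@continuousV _ _ (fun s : R => s ^+ 2 * (pi ^+ 2 + ln s ^+ 2))).
  by rewrite mulf_neq0 ?expf_neq0 ?gt_eqF// pi2_ln2_gt0.
have cX (f : R -> R) : {for t, continuous f} ->
    {for t, continuous (fun s => f s ^+ 2)}.
  by move=> cf; apply: continuousM.
apply: continuousM; first by apply: cX; exact: cvg_id.
apply: continuousD; first exact: cst_continuous.
by apply: cX; exact: continuous_ln.
Qed.

Lemma measurable_ramanujan_density : measurable_fun pos v.
Proof.
apply: subspace_continuous_measurable_fun; first exact: measurable_itv.
apply: continuous_in_subspaceT => t /[!inE] /mem_pos.
exact: continuous_ramanujan_density.
Qed.

Lemma mul_ramanujan_density (t : R) : 0 < t ->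
  t * v t = (t * (pi ^+ 2 + ln t ^+ 2))^-1.
Proof.
move=> t0; have p0 := pi2_ln2_gt0 t; rewrite /ramanujan_density.
move: (_ + _) p0 => q q0.
by field; rewrite (gt_eqF t0) (gt_eqF q0).
Qed.

(** The primitive of the Ramanujan weight; it is bounded by 1 / 2 in absolute
    value. *)
Definition atan_ln (t : R) : R := pi^-1 * atan (pi^-1 * ln t).

Lemma is_derive_atan_ln (t : R) : 0 < t -> is_derive t 1 atan_ln (t * v t).
Proof.
move=> t0; have p0 := pi2_ln2_gt0 t; have pi0 : 0 < pi :> R := pi_gt0 R.
have hln := is_derive1_ln t0.
have h : is_derive t 1 (fun s : R => pi^-1 * ln s) (pi^-1 * t^-1).
  by apply: is_derive_eq; rewrite /GRing.scale/=; ring.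
have hc := @is_derive1_comp R atan _ t _ _ (is_derive1_atan _) h.
apply: (is_derive_eq (is_deriveZ pi^-1 hc)).
rewrite /GRing.scale/=.
rewrite mul_ramanujan_density//.
move: (pi : R) (ln t) pi0 p0 => p l pp pl0.
by field; rewrite (gt_eqF t0) (gt_eqF pp) (gt_eqF pl0).
Qed.

Lemma integral_ramanujan_weight_le1 (a b : R) : 0 < a -> a < b ->
  (\int[mu]_(t in `[a, b]) (t * v t)%:E <= 1)%E.
Proof.
move=> a0 ab.
have gta (t : R) : a <= t -> 0 < t by exact: lt_le_trans.
have dW (t : R) : t \in `]a, b[%R -> is_derive t 1 atan_ln (t * v t).
  by rewrite in_itv/= => /andP[/ltW /gta t0 _]; exact: is_derive_atan_ln.
have cW (t : R) : 0 < t -> {for t, continuous atan_ln}.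
  move=> t0; apply/differentiable_continuous/derivable1_diffP.
  by have [] := is_derive_atan_ln t t0.
rewrite (@continuous_FTC2 _ (fun t => t * v t) atan_ln) //.
- rewrite -EFinB lee_fin -mulrBr mulrC ler_pdivrMr ?pi_gt0// mul1r.
  have := atan_ltpi2 (pi^-1 * ln b); have := atan_gtNpi2 (pi^-1 * ln a); lra.
- apply: continuous_in_subspaceT => t /[!inE]/=.
  rewrite in_itv/= => /andP[/gta t0 _].
  by apply: continuousM; [exact: cvg_id|exact: continuous_ramanujan_density].
- split.
  + by move=> t /dW[].
  + by apply: cvg_at_right_filter; exact: cW.
  + by apply: cvg_at_left_filter; apply: cW; exact: lt_trans ab.
- by move=> t /dW[_]; rewrite derive1E.
Qed.

(** The shift by 2 keeps each interval non-degenerate. *)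
Lemma pos_bigcup : pos = \bigcup_n `[(n.+2%:R)^-1, n.+2%:R]%classic.
Proof.
apply/seteqP; split => t /=.
- move=> /mem_pos t0.
  have [n nE] : exists n : nat, Num.max t t^-1 <= n%:R :> R.
    exists (Num.bound (Num.max t t^-1)); apply/ltW.
    by apply: archi_boundP; rewrite le_max (ltW t0).
  have {}nE : Num.max t t^-1 <= n.+2%:R.
    by apply: le_trans nE _; rewrite ler_nat -addn2 leq_addr.
  move: nE; rewrite ge_max => /andP[tn tVn].
  exists n => //=; rewrite in_itv/= tn andbT.
  by rewrite -[leRHS]invrK lef_pV2 ?posrE// invr_gt0.
- move=> [n _] /=; rewrite !in_itv/= andbT => /andP[+ _].
  by apply: lt_le_trans; rewrite invr_gt0.
Qed.

Lemma integrable_ramanujan_weight :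
  mu.-integrable pos (fun t => (t * v t)%:E).
Proof.
have mw : measurable_fun pos (fun t => (t * v t)%:E).
  apply/measurable_EFinP; apply: measurable_funM => //.
  exact: measurable_ramanujan_density.
have w0 (t : R) : 0 < t -> 0 <= t * v t.
  by move=> t0; rewrite mulr_ge0 ?ramanujan_density_ge0// ltW.
apply/integrableP; split => //.
under eq_integral => t /[!inE] /mem_pos t0.
  rewrite gee0_abs; last by rewrite lee_fin w0.
  over.
pose A n : set (measurableTypeR R) := `[(n.+2%:R)^-1, n.+2%:R]%classic.
have Apos n : A n `<=` pos by rewrite pos_bigcup; exact: bigcup_sup.
have mA n : measurable (A n) by exact: measurable_itv.
have Acvg : (\int[mu]_(t in A n) (t * v t)%:E @[n --> \oo] -->
    \int[mu]_(t in \bigcup_n A n) (t * v t)%:E)%E.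
  apply: ge0_nondecreasing_set_cvg_integral => //.
  - apply/nondecreasing_seqP => n; apply/subsetPset.
    apply: subset_itv; rewrite bnd_simp ?ler_nat//.
    by rewrite lef_pV2 ?posrE// ler_nat.
  - by move=> n; apply: measurable_funS mw => //; exact: measurable_itv.
  - by move=> n t /Apos/mem_pos t0; rewrite lee_fin w0.
rewrite pos_bigcup; apply: (@le_lt_trans _ _ 1%E); last exact: ltry.
rewrite -(cvg_lim _ Acvg)//; apply: lime_le.
  by apply/cvg_ex; eexists; exact: Acvg.
near=> n; apply: integral_ramanujan_weight_le1; first by rewrite invr_gt0.
apply: (@lt_trans _ _ 1); last by rewrite ltr1n.
by rewrite invf_lt1 ?ltr1n.
Unshelve. all: by end_near. Qed.

Lemma ramanujan_levy_integralE (x : R) : 0 < x ->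
  ramanujan_levy_integral x = (levyR v x)%:E.
Proof.
move=> x0; rewrite /levyR /Rintegral fineK//.
apply: integrable_fin_num; first exact: measurable_itv.
apply: (integrable_levy v) => //.
- by move=> t _; exact: ramanujan_density_ge0.
- exact: measurable_ramanujan_density.
- exact: integrable_ramanujan_weight.
Qed.

Lemma ramanujan_integralE (x : R) : 0 < x ->
  ramanujan_integral x = (laplaceR v 0 x)%:E.
Proof.
move=> x0; rewrite /laplaceR /Rintegral fineK//.
  rewrite /ramanujan_integral; apply: eq_integral => t /[!inE] /mem_pos t0.
  by congr EFin; rewrite expr1 mulrAC mul_ramanujan_density// mulrC.
apply: integrable_fin_num; first exact: measurable_itv.
apply: (integrable_laplace v) => //.
- by move=> t _; exact: ramanujan_density_ge0.
- exact: measurable_ramanujan_density.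
- exact: integrable_ramanujan_weight.
Qed.

End ramanujan_density.

(** * The antiderivatives of the Ramanujan integral *)

Theorem theorem8 (R : realType) :
  (exists F : R -> R, ramanujan_antiderivative F /\ bernstein F) /\
  (forall F : R -> R, ramanujan_antiderivative F -> bernstein F ->
     exists a : R,
       [/\ 0 <= a,
           F x @[x --> 0^'+] --> a
         & forall x : R, 0 < x ->
             (F x)%:E = (a%:E + ramanujan_levy_integral x)%E]).
Proof.
pose v := @ramanujan_density R.
have v0 (t : R) : 0 < t -> 0 <= v t by move=> _; exact: ramanujan_density_ge0.
have mv := @measurable_ramanujan_density R.
have iv := @integrable_ramanujan_weight R.
have dL (x : R) : 0 < x -> is_derive x 1 (levyR v) (laplaceR v 0 x).
  exact: is_derive_levy.
split.
  exists (levyR v); split; last exact: bernstein_levyR.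
  move=> x x0; split; first by have [] := dL _ x0.
  by rewrite ramanujan_integralE// derive1E; have [_ ->] := dL _ x0.
move=> F dF [F0 _ _].
have FL : forall x : R, 0 < x -> F x = F 1 - levyR v 1 + levyR v x.
  apply: (eq_derive_pos_cst F (levyR v) (laplaceR v 0)) => // x x0.
  have [Fx /eqP] := dF _ x0; rewrite ramanujan_integralE// eqe => /eqP <-.
  by rewrite derive1E; exact: DeriveDef.
have Fcvg : F x @[x --> 0^'+] --> F 1 - levyR v 1.
  have : (F 1 - levyR v 1) + levyR v x @[x --> 0^'+] --> (F 1 - levyR v 1) + 0.
    apply: cvgD; first exact: cvg_cst.
    exact: levyR_cvg0.
  rewrite addr0; apply: cvg_trans; apply: near_eq_cvg.
  by near=> x; rewrite [RHS]FL//; near: x; exact: nbhs_right_gt.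
exists (F 1 - levyR v 1); split => //.
- rewrite -(cvg_lim _ Fcvg)//; apply: limr_ge.
    by apply/cvg_ex; eexists; exact: Fcvg.
  by near=> x; apply: F0; near: x; exact: nbhs_right_gt.
- by move=> x x0; rewrite FL// ramanujan_levy_integralE.
Unshelve. all: by end_near. Qed.
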